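(* Let $L(\lambda)=\lambda^3A_3+\lambda^2A_2+\lambda A_1+A_0$ be a matrix polynomial with Hermitian coefficients in $\mathbb C^{n,n}$ such that $A_3,A_2,A_0>0$, $A_1\ge0$ and $A_2+A_1>0$. Then the spectrum of $L(\lambda)$ lies outside the set $$\{z\in\mathbb C : \operatorname{Re}z>0,\ -\beta_*<\operatorname{Im}z<\beta_*,\ \arctan(-\beta_* )<\arg z<\arctan(\beta_* )\},$$ where $$\beta_*=\sup\left\{\beta\ge0\ \left|\ \begin{bmatrix}A_3&-\beta\,\mathrm iA_3\\ \mathrm i\beta A_3&A_1+A_2\end{bmatrix}>0\right.\right\}.$$ If, additionally, $A_2\ge A_3$ and $A_1\ge A_0$, then all eigenvalues of $L(\lambda)$ lie in the closed left half-plane.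
   Context: For Hermitian matrices, $M>0$ ($M\ge 0$) means positive definite (positive semidefinite), and $M\ge N$ means $M-N\ge0$. The eigenvalues (spectrum) of $L(\lambda)$ are the $\lambda_0\in\mathbb C$ with $\det L(\lambda_0)=0$. The argument is taken in $(-\pi,\pi]$. *)

(* Defs.v *)
From HB Require Import structures.
From mathcomp Require Import all_boot all_order all_algebra.
From mathcomp Require Import all_classical all_reals all_analysis.
From mathcomp Require Import complex.

Set Implicit Arguments.
Unset Strict Implicit.
Unset Printing Implicit Defensive.

Import Order.TTheory GRing.Theory Num.Theory.
Local Open Scope ring_scope.
Local Open Scope classical_set_scope.
Local Open Scope complex_scope.
Local Open Scope sesquilinear_scope.

(* On R[i], [0 < w] (resp. [0 <= w]) means that w is real and positive
   (resp. nonnegative). *)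
Definition posdefmx (R : realType) (n : nat) (M : 'M[R[i]]_n) : Prop :=
  M \is hermsymmx /\
  forall x : 'cV[R[i]]_n, x != 0 -> 0 < (x^t* *m M *m x) ord0 ord0.

Definition psdmx (R : realType) (n : nat) (M : 'M[R[i]]_n) : Prop :=
  M \is hermsymmx /\
  forall x : 'cV[R[i]]_n, 0 <= (x^t* *m M *m x) ord0 ord0.

Definition loewner_ge (R : realType) (n : nat) (M N : 'M[R[i]]_n) : Prop :=
  psdmx (M - N).

Definition cubic_mxpoly (R : realType) (n : nat) (A3 A2 A1 A0 : 'M[R[i]]_n)
    (z : R[i]) : 'M[R[i]]_n :=
  z ^+ 3 *: A3 + z ^+ 2 *: A2 + z *: A1 + A0.

Definition spectrum (R : realType) (n : nat) (L : R[i] -> 'M[R[i]]_n) :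
    set R[i] :=
  [set z | \det (L z) = 0].

(* [xget 0 E] is an element of E if there is one, and 0 otherwise; see
   [cargP] and [carg_unique] below. *)
Definition carg (R : realType) (z : R[i]) : R :=
  xget 0 [set t : R | - pi < t <= pi /\
                      z = `|z| * (cos t +i* sin t)].

Definition beta_block (R : realType) (n : nat) (A3 A2 A1 : 'M[R[i]]_n)
    (b : R) : 'M[R[i]]_(n + n) :=
  block_mx A3 (- (0 +i* b) *: A3) ((0 +i* b) *: A3) (A1 + A2).

(* For n > 0 and A3, A2 + A1 > 0 this set contains 0 and is bounded above, so
   that [sup] is its least upper bound. *)
Definition beta_star (R : realType) (n : nat) (A3 A2 A1 : 'M[R[i]]_n) : R :=
  sup [set b : R | 0 <= b /\ posdefmx (beta_block A3 A2 A1 b)].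

Definition excluded_region (R : realType) (b : R) : set R[i] :=
  [set z | [/\ 0 < complex.Re z, - b < complex.Im z < b
             & atan (- b) < carg z < atan b]].

Lemma carg_unique (R : realType) (z : R[i]) (s t : R) : z != 0 ->
  - pi < s <= pi -> z = `|z| * (cos s +i* sin s) ->
  - pi < t <= pi -> z = `|z| * (cos t +i* sin t) -> s = t.
Proof.
move=> z0 /andP[s1 s2] zs /andP[t1 t2]; rewrite {1}zs.
have nz0 : `|z| != 0 by rewrite normr_eq0.
move=> /(mulfI nz0)[ec es].
have sgn (u : R) : - pi < u -> u <= pi -> (0 <= sin u) = (0 <= u).
  move=> u1 u2; have [u0|u0] := leP 0 u; first by rewrite sin_ge0_pi// u0.
  apply/negbTE; rewrite -ltNge -oppr_gt0 -sinN sin_gt0_pi//.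
  by rewrite oppr_gt0 u0 ltrNl.
have := sgn s s1 s2; rewrite es sgn//.
have [s0|s0] := leP 0 s; have [t0|t0] := leP 0 t => // _.
  by apply: cos_inj => //; rewrite in_itv/= ?s0 ?t0.
apply: oppr_inj; apply: cos_inj; rewrite ?cosN// in_itv/= oppr_ge0.
  by rewrite (ltW s0) lerNl ltW.
by rewrite (ltW t0) lerNl ltW.
Qed.

Lemma cargP (R : realType) (z : R[i]) :
  - pi < carg z <= pi /\ z = `|z| * (cos (carg z) +i* sin (carg z)).
Proof.
rewrite /carg; case: xgetP => [t -> //|/= none]; exfalso.
have [z0|z0] := eqVneq z 0.
  apply: (none 0); split; first by rewrite oppr_lt0 pi_gt0 pi_ge0.
  by rewrite z0 normr0 mul0r.
case: z z0 none => a b z0 none.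
have nE : `|a +i* b| = (Num.sqrt (a ^+ 2 + b ^+ 2))%:C by rewrite normc_def.
set r := Num.sqrt _ in nE.
have r0 : r != 0.
  by apply: contra z0 => /eqP r0; rewrite -normr_eq0 nE r0.
have rp : 0 < r by rewrite lt_neqAle eq_sym r0 sqrtr_ge0.
have r2 : r ^+ 2 = a ^+ 2 + b ^+ 2 by rewrite sqr_sqrtr// addr_ge0 ?sqr_ge0.
have [u1 u2] : -1 <= a / r /\ a / r <= 1.
  apply/andP; rewrite -ler_norml normrM normfV (gtr0_norm rp).
  rewrite ler_pdivrMr// mul1r -ler_sqr ?nnegrE ?(ltW rp)//.
  by rewrite real_normK ?num_real// r2 lerDl sqr_ge0.
have u12 : -1 <= a / r <= 1 by rewrite u1.
have cE : cos (acos (a / r)) = a / r by rewrite acosK// in_itv.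
have sE : sin (acos (a / r)) = `|b| / r.
  rewrite sin_acos// -[RHS]ger0_norm ?divr_ge0 ?(ltW rp)// -sqrtr_sqr.
  congr Num.sqrt; rewrite !expr_div_n real_normK ?num_real//.
  by rewrite -(divff (expf_neq0 2 r0)) -mulrBl {1}r2 addrAC subrr add0r.
have eqz (t : R) : cos t = a / r -> sin t = b / r ->
    a +i* b = `|a +i* b| * (cos t +i* sin t).
  move=> -> ->; rewrite nE; simpc.
  by rewrite !mulrA ![r * _]mulrC !mulfK.
have [b0|b0] := leP 0 b.
  apply: (none (acos (a / r))); split.
    rewrite acos_lepi// andbT (lt_le_trans _ (acos_ge0 u12))//.
    by rewrite oppr_lt0 pi_gt0.
  by apply: eqz; rewrite ?sE ?ger0_norm.
have um : -1 < a / r.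
  rewrite lt_neqAle u1 andbT; apply/eqP => e.
  have ae : a = - r by rewrite -[a](divfK r0) -e mulN1r.
  move: r2; rewrite ae sqrrN -{1}[r ^+ 2]addr0 => /addrI/esym/eqP.
  by rewrite sqrf_eq0 (lt_eqF b0).
apply: (none (- acos (a / r))); split.
  rewrite ltrN2 acos_ltpi ?um//= (le_trans _ (pi_ge0 R))//.
  by rewrite oppr_le0 acos_ge0.
by apply: eqz; rewrite ?cosN ?sinN ?sE// ltr0_norm// mulNr opprK.
Qed.

(* Main.v *)
Require Import Defs.
From mathcomp Require Import all_boot all_order all_algebra.
From mathcomp Require Import all_classical all_reals all_analysis.
From mathcomp Require Import complex.
From mathcomp Require Import ring lra.

(** The matrix statement reduces to one about scalar cubics.  If [z] is an
    eigenvalue with eigenvector [x], then [z] is a root of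
    [a3 z^3 + a2 z^2 + a1 z + a0], where [aj = x^* Aj x] is real, with
    [a3, a2, a0 > 0] and [a1 >= 0] ([cubic_qform_eq0]).

    Write [z = u + iv] with [u > 0].  The real part of the cubic divided by
    [z] is [a3 (u^2 - v^2) + a2 u + a1 + a0 u / |z|^2 = 0], so
    [a3 v^2 > a2 u + a1].  If [u >= 1], this gives
    [a3 v^2 > a2 + a1]; if [u <= 1], dividing by [u^2] gives
    [a3 (v / u)^2 > a2 + a1].  Hence [b^2 a3 > a2 + a1] for every [b] that
    bounds both [|v|] and [|v| / u] ([cubic_root_Im_gt]).

    In the excluded region [|v|] and [|v| / u], the latter being the absolute
    value of the tangent of the argument ([carg_sector]), are both below
    [beta_*].  So some [b] above both makes the block matrix positive definite
    ([beta_star_gt]), and evaluating that matrix at the vector [(ibx, x)]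
    gives [b^2 a3 < a2 + a1] ([beta_block_qform]), a contradiction.

    For the second claim, [A2 >= A3] and [A1 >= A0] give [a3 a0 <= a2 a1],
    the Routh-Hurwitz condition that keeps the roots of a real cubic in the
    closed left half-plane ([cubic_root_Re_le0]). *)

Import Order.TTheory GRing.Theory Num.Theory.
Local Open Scope ring_scope.
Local Open Scope classical_set_scope.
Local Open Scope complex_scope.

Lemma cubic_ReIm_eq0 {R : realType} {a3 a2 a1 a0 u v : R} :
  (u +i* v) ^+ 3 * a3%:C + (u +i* v) ^+ 2 * a2%:C + (u +i* v) * a1%:C + a0%:C
    = 0 ->
  a3 * (u ^+ 3 - 3 * u * v ^+ 2) + a2 * (u ^+ 2 - v ^+ 2) + a1 * u + a0 = 0 /\
  v * (a3 * (3 * u ^+ 2 - v ^+ 2) + 2 * a2 * u + a1) = 0.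
Proof.
rewrite !exprS !expr0 !mulr1; simpc => -[eRe eIm].
by split; [rewrite -[RHS]eRe | rewrite -[RHS]eIm]; ring.
Qed.

(** The form of the statement with a common bound [b] serves the two cases of
    the proof at once: the bound on [|v|] is what matters for [1 <= u], and
    the bound on [|v| / u] for [u < 1]. *)
Lemma cubic_root_Im_gt {R : realType} {a3 a2 a1 a0 u v b : R} :
  0 < a3 -> 0 < a2 -> 0 <= a1 -> 0 < a0 -> 0 < u ->
  `|v| <= b -> `|v| <= b * u ->
  (u +i* v) ^+ 3 * a3%:C + (u +i* v) ^+ 2 * a2%:C + (u +i* v) * a1%:C + a0%:C
    = 0 ->
  a2 + a1 < b ^+ 2 * a3.
Proof.
move=> a3p a2p a1p a0p up vb vbu /cubic_ReIm_eq0[eRe eIm].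
have m_gt0 : 0 < u ^+ 2 + v ^+ 2 by rewrite ltr_wpDr ?sqr_ge0 ?exprn_gt0.
(* the real part of the cubic divided by [z], times [|z|^2]: it is the real
   part of the cubic times the conjugate of [z] *)
have eq0 : (u ^+ 2 + v ^+ 2) * (a3 * (u ^+ 2 - v ^+ 2) + a2 * u + a1)
           = - (a0 * u).
  apply: (@addIr _ (a0 * u)); rewrite addNr.
  transitivity (u * 0 + v * 0 : R); last by rewrite !mulr0 addr0.
  by rewrite -[in u * 0]eRe -[in v * 0]eIm; ring.
have lt0 : a3 * (u ^+ 2 - v ^+ 2) + a2 * u + a1 < 0.
  by rewrite -(pmulr_rlt0 _ m_gt0) eq0 oppr_lt0 mulr_gt0.
have sq_le c : `|v| <= c -> v ^+ 2 <= c ^+ 2.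
  move=> vc; rewrite -(real_normK (num_real v)) lerXn2r ?nnegrE//.
  exact: le_trans vc.
have vb2 := sq_le _ vb; have := sq_le _ vbu; rewrite exprMn => vbu2.
have u2p : 0 < u ^+ 2 by rewrite exprn_gt0.
have [u1|u1] := leP 1 u.
  have : a3 * v ^+ 2 <= a3 * b ^+ 2 by rewrite ler_pM2l.
  have : 0 < a3 * u ^+ 2 by rewrite mulr_gt0.
  have : a2 * 1 <= a2 * u by rewrite ler_pM2l.
  lra.
rewrite -(ltr_pM2r u2p).
have : a3 * v ^+ 2 <= a3 * (b ^+ 2 * u ^+ 2) by rewrite ler_pM2l.
have : 0 < a3 * u ^+ 2 by rewrite mulr_gt0.
have u2u : u ^+ 2 <= u by rewrite expr2 -[leRHS]mulr1 ler_pM2l ?ltW.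
have : a2 * u ^+ 2 <= a2 * u by rewrite ler_pM2l.
have : a1 * u ^+ 2 <= a1 * 1 by rewrite ler_wpM2l// (le_trans u2u) ?ltW.
lra.
Qed.

(** Routh-Hurwitz for cubics.  At a root with [v != 0] the imaginary part
    determines [v^2]; substituting it in the real part leaves a sum of
    nonnegative terms that is positive as soon as [u > 0]. *)
Lemma cubic_root_Re_le0 {R : realType} {a3 a2 a1 a0 : R} {z : R[i]} :
  0 < a3 -> 0 < a2 -> 0 <= a1 -> 0 < a0 -> a3 * a0 <= a2 * a1 ->
  z ^+ 3 * a3%:C + z ^+ 2 * a2%:C + z * a1%:C + a0%:C = 0 ->
  complex.Re z <= 0.
Proof.
case: z => u v a3p a2p a1p a0p hurwitz /cubic_ReIm_eq0[eRe /eqP].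
rewrite mulf_eq0 /= => /orP[/eqP v0|/eqP eIm]; rewrite leNgt; apply/negP => up.
  have : 0 < a3 * u ^+ 3 + a2 * u ^+ 2 + a1 * u + a0.
    by rewrite ltr_wpDl// !addr_ge0// mulr_ge0 ?exprn_ge0// ?ltW ?exprn_gt0.
  suff -> : a3 * u ^+ 3 + a2 * u ^+ 2 + a1 * u + a0 = 0 by rewrite ltxx.
  by rewrite -[RHS]eRe v0; ring.
(* [v ^+ 2] is eliminated between [eIm] and [a3] times [eRe]; the multiplier
   [3 a3 u + a2] is minus the coefficient of [v ^+ 2] in [eRe] *)
have : a2 * a1 - a3 * a0 + (8 * a3 ^+ 2 * u ^+ 3 + 8 * a3 * a2 * u ^+ 2
       + 2 * a1 * a3 * u) + 2 * a2 ^+ 2 * u = 0.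
  transitivity ((3 * a3 * u + a2) * 0 - a3 * 0 : R); last first.
    by rewrite !mulr0 subr0.
  by rewrite -[in a3 * 0]eRe -[in _ * 0 - _]eIm; ring.
apply/eqP; rewrite gt_eqF// ltr_wpDl//.
  by rewrite addr_ge0 ?subr_ge0// !addr_ge0// !mulr_ge0 ?exprn_ge0 ?ler0n//
             ltW.
by rewrite !mulr_gt0 ?exprn_gt0.
Qed.

Section QuadraticForm.
Local Open Scope sesquilinear_scope.
Context {R : realType}.
Implicit Types n : nat.

(** The real part loses nothing on the positive semidefinite matrices, whose
    quadratic forms are real ([psd_qformE]), and makes [qform x] an additive
    map into an ordered field. *)
Definition qform {n} (x : 'cV[R[i]]_n) (A : 'M[R[i]]_n) : R :=
  complex.Re ((x^t* *m A *m x) ord0 ord0).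

Lemma qformB n (x : 'cV[R[i]]_n) A B : qform x (A - B) = qform x A - qform x B.
Proof.
by rewrite /qform mulmxBr mulmxBl !mxE; case: (\sum_j _); case: (\sum_j _).
Qed.

Lemma qformD n (x : 'cV[R[i]]_n) A B : qform x (A + B) = qform x A + qform x B.
Proof.
by rewrite /qform mulmxDr mulmxDl !mxE; case: (\sum_j _); case: (\sum_j _).
Qed.

Lemma qformZ n (x : 'cV[R[i]]_n) (c : R) A : qform x (c%:C *: A) = c * qform x A.
Proof.
rewrite /qform -scalemxAr -scalemxAl mxE; case: (_ ord0 ord0) => a b /=.
by rewrite mul0r subr0.
Qed.

Lemma psd_qformE {n} {A : 'M[R[i]]_n} (x : 'cV[R[i]]_n) : psdmx A ->
  (x^t* *m A *m x) ord0 ord0 = (qform x A)%:C /\ 0 <= qform x A.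
Proof.
move=> [_ /(_ x)]; rewrite /qform; case: (_ ord0 ord0) => a b.
by rewrite lecE /= => /andP[/eqP -> ->].
Qed.

Lemma posdef_psd {n} {A : 'M[R[i]]_n} : posdefmx A -> psdmx A.
Proof.
move=> [hA pA]; split=> // x; have [->|/pA/ltW//] := eqVneq x 0.
by rewrite mulmx0 mxE.
Qed.

Lemma posdef_qform_gt0 {n} {A : 'M[R[i]]_n} {x : 'cV[R[i]]_n} :
  posdefmx A -> x != 0 -> 0 < qform x A.
Proof.
move=> [_ pA] /pA; rewrite /qform; case: (_ ord0 ord0) => a b.
by rewrite ltcE => /andP[].
Qed.

Lemma loewner_qform {n} {A B : 'M[R[i]]_n} (x : 'cV[R[i]]_n) :
  loewner_ge A B -> qform x B <= qform x A.
Proof. by move=> /(psd_qformE x)[_]; rewrite qformB subr_ge0. Qed.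

Lemma spectrum_kernel {n} {L : R[i] -> 'M[R[i]]_n} {z} :
  spectrum L z -> exists2 x : 'cV[R[i]]_n, x != 0 & L z *m x = 0.
Proof.
move=> /eqP; rewrite -det_tr => /det0P[x x0 xL]; exists x^T.
  by rewrite -(inj_eq trmx_inj) trmxK trmx0.
by apply: trmx_inj; rewrite trmx_mul trmxK xL trmx0.
Qed.

Lemma cubic_qform_eq0 {n} {A3 A2 A1 A0 : 'M[R[i]]_n} {z x} :
  psdmx A3 -> psdmx A2 -> psdmx A1 -> psdmx A0 ->
  cubic_mxpoly A3 A2 A1 A0 z *m x = 0 ->
  z ^+ 3 * (qform x A3)%:C + z ^+ 2 * (qform x A2)%:C
    + z * (qform x A1)%:C + (qform x A0)%:C = 0.
Proof.
move=> /(psd_qformE x)[<- _] /(psd_qformE x)[<- _] /(psd_qformE x)[<- _].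
move=> /(psd_qformE x)[<- _] Lx0.
transitivity ((x^t* *m (cubic_mxpoly A3 A2 A1 A0 z *m x)) ord0 ord0).
  rewrite /cubic_mxpoly mulmxA !mulmxDr !mulmxDl -!scalemxAr -!scalemxAl.
  by rewrite !mxE.
by rewrite Lx0 mulmx0 mxE.
Qed.

(** For fixed lower half [x], the form of the block matrix is smallest at the
    vector [(ibx, x)], where it equals [x^* (A1 + A2 - b^2 A3) x]: the test
    vector realises the Schur complement of [A3]. *)
Lemma beta_block_qform {n} {A3 A2 A1 : 'M[R[i]]_n} {b : R} {x : 'cV[R[i]]_n} :
  x != 0 -> posdefmx (beta_block A3 A2 A1 b) ->
  b ^+ 2 * qform x A3 < qform x A2 + qform x A1.
Proof.
move=> x0 pB.
have y0 : col_mx ((0 +i* b) *: x) x != 0.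
  by rewrite col_mx_eq0 negb_and x0 orbT.
have := posdef_qform_gt0 pB y0.
have conj_y : ((0 +i* b) *: x)^t* = - (0 +i* b) *: x^t*.
  by rewrite linearZ /= map_mxZ; congr (_ *: _); simpc.
have i2 : (0 +i* b) * (0 +i* b) = - (b ^+ 2)%:C by simpc; rewrite expr2.
rewrite {1}/qform /beta_block tr_col_mx map_row_mx mul_row_block mul_row_col.
rewrite conj_y.
rewrite -!scalemxAl -!scalemxAr.
rewrite {1}scaleNr addNr mul0mx.
rewrite scaler0 add0r scalerA mulrNN i2 scaleNr scalemxAr -mulmxN -mulmxDr.
by rewrite -/(qform x _) addrC qformB qformD qformZ subr_gt0 addrC.
Qed.
End QuadraticForm.

(** Between [atan (- b)] and [atan b] the cosine is positive and the tangent is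
    increasing, so the condition on the argument is one on [Im z / Re z]. *)
Lemma carg_sector {R : realType} {z : R[i]} {b : R} :
  0 < complex.Re z -> atan (- b) < carg z < atan b ->
  `|complex.Im z| < b * complex.Re z.
Proof.
have [_] := cargP z; set t := carg z => zE u_gt0 /andP[lt_t t_lt].
have t_in : - (pi / 2) < t < pi / 2.
  by rewrite (lt_trans (atan_gtNpi2 _) lt_t) (lt_trans t_lt (atan_ltpi2 _)).
have c_gt0 : 0 < cos t by apply: cos_gt0_pihalf.
have imE : complex.Im z = tan t * complex.Re z.
  rewrite zE normc_def; simpc => /=.
  by rewrite /tan; field; rewrite gt_eqF.
have atan_lt : {mono @atan R : x y / x < y}.
  by apply: leW_mono; apply: le_mono; exact: lt_atan.
rewrite imE normrM (gtr0_norm u_gt0) ltr_pM2r// ltr_norml.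
by rewrite -[- b < _]atan_lt -[tan t < b]atan_lt tanK ?in_itv// lt_t.
Qed.

(** The hypothesis [0 <= c] makes the set defining [beta_star] nonempty, as the
    supremum of the empty set is [0] here. *)
Lemma beta_star_gt {R : realType} {n} {A3 A2 A1 : 'M[R[i]]_n} {c : R} :
  0 <= c -> c < beta_star A3 A2 A1 ->
  exists2 b, posdefmx (beta_block A3 A2 A1 b) & c < b.
Proof.
rewrite /beta_star; set S := [set b | _] => c0 cS.
have [S0|/set0P/sup_gt] := eqVneq S set0.
  by move: cS; rewrite S0 sup0 ltNge c0.
by move=> /(_ _ cS)[b [_ pB] cb]; exists b.
Qed.

Theorem theorem6p8 (R : realType) (n : nat) (A3 A2 A1 A0 : 'M[R[i]]_n)
    (n_gt0 : (0 < n)%N)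
    (A3_herm : A3 \is hermsymmx) (A2_herm : A2 \is hermsymmx)
    (A1_herm : A1 \is hermsymmx) (A0_herm : A0 \is hermsymmx)
    (A3_pos : posdefmx A3) (A2_pos : posdefmx A2) (A0_pos : posdefmx A0)
    (A1_psd : psdmx A1) (A21_pos : posdefmx (A2 + A1)) :
  spectrum (cubic_mxpoly A3 A2 A1 A0)
    `<=` ~` excluded_region (beta_star A3 A2 A1) /\
  (loewner_ge A2 A3 -> loewner_ge A1 A0 ->
    spectrum (cubic_mxpoly A3 A2 A1 A0) `<=` [set z | complex.Re z <= 0]).
Proof.
have scalar_root z : spectrum (cubic_mxpoly A3 A2 A1 A0) z ->
    exists2 x : 'cV[R[i]]_n, x != 0 &
      z ^+ 3 * (qform x A3)%:C + z ^+ 2 * (qform x A2)%:C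
        + z * (qform x A1)%:C + (qform x A0)%:C = 0.
  move=> /spectrum_kernel[x x0 Lx0]; exists x => //.
  by apply: cubic_qform_eq0 Lx0 => //; exact: posdef_psd.
split=> [z|A23 A10 z] /scalar_root[x x0 root_z];
  have a3 := posdef_qform_gt0 A3_pos x0; have a2 := posdef_qform_gt0 A2_pos x0;
  have a0 := posdef_qform_gt0 A0_pos x0; have [_ a1] := psd_qformE x A1_psd.
  move=> [u_gt0 im_lt /(carg_sector u_gt0)].
  case: z root_z u_gt0 im_lt => u v root_z /= u_gt0; rewrite -ltr_norml.
  move=> v_lt vu_lt.
  (* the smallest bound on both [|v|] and the slope [|v| / u] *)
  pose c := Num.max `|v| (`|v| / u).
  have c_ge0 : 0 <= c by rewrite le_max normr_ge0.
  have c_lt : c < beta_star A3 A2 A1 by rewrite gt_max v_lt ltr_pdivrMr.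
  have [b pB c_lt_b] := beta_star_gt c_ge0 c_lt.
  have [v_le vu_le] : `|v| <= b /\ `|v| <= b * u.
    by move: c_lt_b; rewrite gt_max ltr_pdivrMr// => /andP[/ltW ? /ltW].
  have := cubic_root_Im_gt a3 a2 a1 a0 u_gt0 v_le vu_le root_z.
  by rewrite ltNge (ltW (beta_block_qform x0 pB)).
apply: (cubic_root_Re_le0 a3 a2 a1 a0 _ root_z).
by apply: ler_pM; [exact: ltW | exact: ltW | exact: loewner_qform..].
Qed.
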